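(* Let $C\subset\mathbb{R}^n$ be nonempty, compact and convex, let $U\subset\mathbb{R}^n$ be open and convex with $C\cap U\neq\emptyset$, and let $f:U\to\mathbb{R}$ be twice continuously differentiable and convex. Assume boundary blow-up: for every $\alpha\in\mathbb{R}$ such that $L_\alpha:=\{p\in C\cap U\mid f(p)\le\alpha\}$ is nonempty, $\operatorname{dist}(L_\alpha,U^c)>0$. Then the domain-aware Armijo projected gradient method (described in the context), run from $p^{(0)}\in C\cap U$ with parameters $\bar\alpha>0$, $\sigma,\rho\in(0,1)$ and $\varepsilon=0$, either terminates at a minimizer of $f$ over $C\cap U$ or generates an infinite sequence $\{p^{(k)}\}$ that converges to a minimizer of $f$ over $C\cap U$.
   Context: $\|\cdot\|$ is the Euclidean norm, $P_C$ the Euclidean projection onto $C$, $U^c=\mathbb{R}^n\setminus U$, and $\operatorname{dist}(A,B)=\inf\{\|a-b\|: a\in A,b\in B\}$, with the convention $\operatorname{dist}(A,\emptyset)=+\infty$. Domain-aware Armijo projected gradient method. Input: $p^{(0)}\in C\cap U$, $\bar\alpha>0$, $\sigma,\rho\in(0,1)$, $\varepsilon\ge0$. For $k=0,1,\dots$: (backtracking loop) start with $\alpha:=\bar\alpha$ and repeat: set $q:=P_C(p^{(k)}-\alpha\nabla f(p^{(k)}))$; if $q\in U$ and (tested only when $q\in U$) $f(q)\le f(p^{(k)})+\sigma\nabla f(p^{(k)})^\top(q-p^{(k)})$, accept the trial by setting $\alpha_k:=\alpha$, $\tilde p^{(k)}:=q$ and exit the loop; otherwise replace $\alpha$ by $\rho\alpha$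 and repeat. After acceptance, if $\|\tilde p^{(k)}-p^{(k)}\|/\alpha_k\le\varepsilon$, terminate and return $p^{(k)}$; otherwise set $p^{(k+1)}:=\tilde p^{(k)}$. *)

(* Defs.v *)
(* Vectors of R^n are row vectors over an arbitrary real type R. *)
From HB Require Import structures.
From mathcomp Require Import all_boot all_order all_algebra.
From mathcomp Require Import all_classical all_reals all_analysis.

Set Implicit Arguments.
Unset Strict Implicit.
Unset Printing Implicit Defensive.

Import Order.TTheory GRing.Theory Num.Theory.
Import numFieldNormedType.Exports.

Local Open Scope classical_set_scope.
Local Open Scope ring_scope.

Definition dot (R : realType) (n : nat) (u v : 'rV[R]_n) : R :=
  \sum_i u 0 i * v 0 i.

(* The library norm `|u| on 'rV[R]_n is the sup norm. Its topology, used below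
   for open, compact, continuous, differentiable and -->, is the Euclidean one;
   all metric quantities use enorm. *)
Definition enorm (R : realType) (n : nat) (u : 'rV[R]_n) : R :=
  Num.sqrt (dot u u).

(* ereal_inf set0 = +oo, hence set_dist A set0 = +oo. *)
Definition set_dist (R : realType) (n : nat) (A B : set 'rV[R]_n) : \bar R :=
  ereal_inf [set (enorm (a - b))%:E | a in A & b in B].

(* The default value x is only reached when no nearest point of C exists. *)
Definition proj (R : realType) (n : nat) (C : set 'rV[R]_n) (x : 'rV[R]_n) :
    'rV[R]_n :=
  xget x [set q | C q /\ forall y, C y -> enorm (x - q) <= enorm (x - y)].

(* Functions on an open set U are represented by total functions of which only
   the values on U matter; derivatives at points of U depend on those alone. *)
Definition grad (R : realType) (n : nat) (f : 'rV[R]_n -> R) (x : 'rV[R]_n) :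
    'rV[R]_n :=
  \row_i 'D_(delta_mx 0 i) f x.

Definition C2_on (R : realType) (n : nat) (U : set 'rV[R]_n)
    (f : 'rV[R]_n -> R) : Prop :=
  forall x, U x ->
    [/\ differentiable f x, differentiable (grad f) x
      & {for x, continuous (jacobian (grad f))}].

Definition sublevel (R : realType) (n : nat) (D : set 'rV[R]_n)
    (f : 'rV[R]_n -> R) (a : R) : set 'rV[R]_n :=
  [set p | D p /\ f p <= a].

Definition is_minimizer (R : realType) (n : nat) (D : set 'rV[R]_n)
    (f : 'rV[R]_n -> R) (p : 'rV[R]_n) : Prop :=
  D p /\ forall y, D y -> f p <= f y.

Definition trial (R : realType) (n : nat) (C : set 'rV[R]_n)
    (f : 'rV[R]_n -> R) (p : 'rV[R]_n) (alpha : R) : 'rV[R]_n :=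
  proj C (p - alpha *: grad f p).

Definition accepts (R : realType) (n : nat) (C U : set 'rV[R]_n)
    (f : 'rV[R]_n -> R) (sigma : R) (p : 'rV[R]_n) (alpha : R) : Prop :=
  let q := trial C f p alpha in
  U q /\ f q <= f p + sigma * dot (grad f p) (q - p).

(* backtrack C U f sigma rho p alpha beta: the backtracking loop at p, entered
   with step alpha, exits with accepted step beta. No beta satisfies this if
   the loop runs forever. *)
Inductive backtrack (R : realType) (n : nat) (C U : set 'rV[R]_n)
    (f : 'rV[R]_n -> R) (sigma rho : R) (p : 'rV[R]_n) : R -> R -> Prop :=
| BtAccept alpha :
    accepts C U f sigma p alpha ->
    backtrack C U f sigma rho p alpha alpha
| BtReject alpha beta :
    ~ accepts C U f sigma p alpha ->
    backtrack C U f sigma rho p (rho * alpha) beta ->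
    backtrack C U f sigma rho p alpha beta.

Definition stationarity (R : realType) (n : nat) (C : set 'rV[R]_n)
    (f : 'rV[R]_n -> R) (p : 'rV[R]_n) (alpha : R) : R :=
  enorm (trial C f p alpha - p) / alpha.

(* armijo_pg_returns ... p r: started at p, the method terminates after
   finitely many iterations and returns r. *)
Inductive armijo_pg_returns (R : realType) (n : nat) (C U : set 'rV[R]_n)
    (f : 'rV[R]_n -> R) (abar sigma rho eps : R) :
    'rV[R]_n -> 'rV[R]_n -> Prop :=
| PgStop p alpha :
    backtrack C U f sigma rho p abar alpha ->
    stationarity C f p alpha <= eps ->
    armijo_pg_returns C U f abar sigma rho eps p p
| PgStep p alpha r :
    backtrack C U f sigma rho p abar alpha ->
    eps < stationarity C f p alpha ->
    armijo_pg_returns C U f abar sigma rho eps (trial C f p alpha) r ->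
    armijo_pg_returns C U f abar sigma rho eps p r.

(* armijo_pg_generates ... p0 p: started at p0, every backtracking loop exits,
   the method never terminates, and its iterates are p 0, p 1, ... *)
Definition armijo_pg_generates (R : realType) (n : nat) (C U : set 'rV[R]_n)
    (f : 'rV[R]_n -> R) (abar sigma rho eps : R) (p0 : 'rV[R]_n)
    (p : nat -> 'rV[R]_n) : Prop :=
  p 0%N = p0 /\
  forall k, exists alpha,
    [/\ backtrack C U f sigma rho (p k) abar alpha,
        eps < stationarity C f (p k) alpha
      & p k.+1 = trial C f (p k) alpha].

(* Main.v *)
Require Import Defs.
From HB Require Import structures.
From mathcomp Require Import all_boot all_order all_algebra.
From mathcomp Require Import all_classical all_reals all_analysis.
From mathcomp Require Import ring lra.

Set Implicit Arguments.
Unset Strict Implicit.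
Unset Printing Implicit Defensive.

Import Order.TTheory GRing.Theory Num.Theory.
Import numFieldNormedType.Exports.

(** Write |.| for the Euclidean norm, g = grad f, and q for the point accepted
    from p with step a, that is the projection on C of p - a g(p).

    The variational inequality of the projection, convexity of f and the Armijo
    test give, for every y of C and U (accepted_quasi_fejer),
      |q - y|^2 + 2 a (f p - f y) <= |p - y|^2 + (2 abar / sigma) (f p - f q).
    So, as long as f y stays below the values at the iterates, the quantity
    |p_k - y|^2 + (2 abar / sigma) f(p_k) is nonincreasing along the run
    (lyap_step).

    By compactness the iterates have a cluster point x in C, and blow-up makes
    the sublevel sets closed (sublevel_closed), so x is in U and f x is at
    most f(p_k) for every k.  Taking y = x above, a nonincreasing sequence of
    terms |p_k - x|^2 + (2 abar / sigma) (f(p_k) - f x) >= 0 has the cluster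
    value 0, hence tends to 0: the whole sequence converges to x
    (iterates_converge).

    It remains to see that x is a minimizer.  Since g is Lipschitz near x, all
    small enough steps are accepted at all points of C near x, with one bound a0
    for the whole neighbourhood (small_steps_accepted).  Backtracking by the
    factor rho therefore ends at a step at least min(abar, rho a0) once p_k is
    near x.  If some y had f y < f x, each late iteration would lower the
    convergent sequence |p_k - y|^2 + (2 abar / sigma) f(p_k) by at least a
    fixed positive amount, which is impossible (iterates_cvg_minimizer).

    Local acceptance also shows that every backtracking loop ends
    (backtrack_exits).  If the method stops, then q = p, and the variational
    inequality reduces to first-order optimality of p (stationary_minimizer). *)

Local Open Scope classical_set_scope.
Local Open Scope ring_scope.

(** * Inner product and norms *)

Section Dot.
Context {R : realType} {n : nat}.
Implicit Types (u v w : 'rV[R]_n) (a : R).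

Lemma dotC u v : dot u v = dot v u.
Proof. by apply: eq_bigr => i _; rewrite mulrC. Qed.

Lemma dotDl u v w : dot (u + v) w = dot u w + dot v w.
Proof. by rewrite -big_split; apply: eq_bigr => i _; rewrite mxE mulrDl. Qed.

Lemma dotZl a u v : dot (a *: u) v = a * dot u v.
Proof. by rewrite mulr_sumr; apply: eq_bigr => i _; rewrite mxE mulrA. Qed.

Lemma dotDr u v w : dot u (v + w) = dot u v + dot u w.
Proof. by rewrite dotC dotDl !(dotC u). Qed.

Lemma dotZr a u v : dot u (a *: v) = a * dot u v.
Proof. by rewrite dotC dotZl dotC. Qed.

Lemma dotNl u v : dot (- u) v = - dot u v.
Proof. by rewrite -scaleN1r dotZl mulN1r. Qed.

Lemma dotNr u v : dot u (- v) = - dot u v.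
Proof. by rewrite dotC dotNl dotC. Qed.

Definition dotE := (dotDl, dotDr, dotNl, dotNr, dotZl, dotZr).

Lemma dot_ge0 u : 0 <= dot u u.
Proof. by apply: sumr_ge0 => i _; rewrite -expr2 sqr_ge0. Qed.

Lemma sqr_enorm u : enorm u ^+ 2 = dot u u.
Proof. by rewrite sqr_sqrtr ?dot_ge0. Qed.

Lemma enorm_le u v : (enorm u <= enorm v) = (dot u u <= dot v v).
Proof. by rewrite ler_sqrt ?dot_ge0. Qed.

Lemma entry_le_norm m k (A : 'M[R]_(m, k)) i j : `|A i j| <= `|A|.
Proof.
rewrite [leRHS]mx_normrE.
exact: (le_bigmax 0 (fun ij : 'I_m * 'I_k => `|A ij.1 ij.2|) (i, j)).
Qed.

Lemma norm_le_coords u a :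
  0 <= a -> (forall i, `|u 0 i| <= a) -> `|u| <= a.
Proof.
move=> a0 ua; rewrite [leLHS]mx_normrE; apply/bigmax_leP; split=> // -[i j] _.
by rewrite /= (ord1 i).
Qed.

(** With [dot_le_norm], this compares the sup norm, which carries the topology,
    with the Euclidean quantities of the algorithm. *)
Lemma sqr_norm_le_dot u : `|u| ^+ 2 <= dot u u.
Proof.
suff u_le : `|u| <= enorm u by rewrite -sqr_enorm ler_pXn2r ?nnegrE ?sqrtr_ge0.
apply: norm_le_coords => [|i]; first exact: sqrtr_ge0.
rewrite -sqrtr_sqr ler_sqrt ?dot_ge0// /dot (bigD1 i)//= -expr2 lerDl.
by apply: sumr_ge0 => j _; rewrite -expr2 sqr_ge0.
Qed.

Lemma dot_le_norm u v : dot u v <= n%:R * `|u| * `|v|.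
Proof.
apply: le_trans (ler_norm _) _; apply: le_trans (ler_norm_sum _ _ _) _.
rewrite -mulrA mulr_natl -[X in _ *+ X]card_ord -sumr_const.
apply: ler_sum => i _.
by rewrite normrM ler_pM ?entry_le_norm.
Qed.

Lemma dot_eq0 u : dot u u = 0 -> u = 0.
Proof.
move=> u0; apply/eqP; rewrite -normr_eq0 -sqrf_eq0 eq_le sqr_ge0 andbT -u0.
exact: sqr_norm_le_dot.
Qed.

Lemma dot_cvg (T : Type) (F : set_system T) {FF : Filter F}
    (g h : T -> 'rV[R]_n) u v :
  g x @[x --> F] --> u -> h x @[x --> F] --> v ->
  dot (g x) (h x) @[x --> F] --> dot u v.
Proof.
move=> gu hv; apply: cvg_big => [|i _]; first exact: add_continuous.
apply: cvgM.
- by exact: (cvg_comp _ _ gu (@coord_continuous R 1 n 0 i u)).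
- by exact: (cvg_comp _ _ hv (@coord_continuous R 1 n 0 i v)).
Qed.

End Dot.

(** * Projection on a compact convex set *)

Lemma convex_setP (R : realType) (n : nat) (D : set 'rV[R]_n) :
  convex_set D -> forall x y t, D x -> D y -> 0 <= t <= 1 ->
  D (x + t *: (y - x)).
Proof.
move=> D_convex x y t Dx Dy /andP[t0 t1].
have := D_convex y x (Itv01 t0 t1) (mem_set Dy) (mem_set Dx).
move/set_mem; congr D; rewrite /conv/= scalerBl scale1r scalerBr.
by rewrite addrCA.
Qed.

Section Projection.
Context {R : realType} {n : nat} (C : set 'rV[R]_n).
Context (C_neq0 : C !=set0) (C_compact : compact C)
  (C_convex : convex_set C).

Lemma proj_nearest x :
  C (Defs.proj C x) /\
  forall y, C y ->
    dot (x - Defs.proj C x) (x - Defs.proj C x) <= dot (x - y) (x - y).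
Proof.
have sub_cont (y : 'rV[R]_n) : (fun z : 'rV[R]_n => x - z) @ y --> x - y.
  by apply: (@cvgB _ _ _ (nbhs y)); [exact: cvg_cst|exact: cvg_id].
have sqr_cont : continuous (fun y : 'rV[R]_n => dot (x - y) (x - y)).
  by move=> y; exact: dot_cvg (sub_cont y) (sub_cont y).
have [q /set_mem Cq qmin] :=
  compact_EVT_min C_neq0 C_compact (continuous_subspaceT sqr_cont).
have [|? xmin] := @xgetPex _ x
    [set q | C q /\ forall y, C y -> enorm (x - q) <= enorm (x - y)].
  by exists q; split=> // y Cy; rewrite enorm_le qmin ?inE.
by split=> // y Cy; rewrite -enorm_le xmin.
Qed.

Lemma proj_in x : C (Defs.proj C x).
Proof. by have [] := proj_nearest x. Qed.

(** Moving from the nearest point q towards y by a fraction t cannot bring it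
    closer to x; the first-order term in t of the squared distance is
    - 2 dot (x - q) (y - q). *)
Lemma proj_variational x y :
  C y -> dot (x - Defs.proj C x) (y - Defs.proj C x) <= 0.
Proof.
have [Cq qmin] := proj_nearest x; set q := Defs.proj C x in Cq qmin * => Cy.
set s := dot _ _; set D := dot (y - q) (y - q).
have sD t : 0 < t <= 1 -> 2 * s <= t * D.
  move=> /andP[t0 t1]; have t01 : 0 <= t <= 1 by rewrite ltW.
  have := qmin _ (convex_setP C_convex Cq Cy t01).
  rewrite opprD addrA !(dotDl (x - q)) !(dotDr _ (x - q)) !dotNl !dotNr.
  rewrite !dotZl !dotZr (dotC (y - q) (x - q)) -/s -/D => h.
  have : t * (2 * s) <= t * (t * D) by lra.
  by rewrite ler_pM2l.
rewrite leNgt; apply/negP => s_gt0.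
(* If s > 0, the fraction s / D, at most 1/2, contradicts sD. *)
have D_ge : 2 * s <= D by rewrite -[D]mul1r sD// ltr01 lexx.
have D_gt0 : 0 < D by lra.
have := sD (s / D); rewrite divr_gt0//= ler_pdivrMr// divfK ?gt_eqF//.
by rewrite mul1r; lra.
Qed.

End Projection.

(** * Derivatives along segments *)

Section Derivatives.
Context {R : realType} {n : nat}.
Implicit Types (f : 'rV[R]_n -> R) (x p q d v : 'rV[R]_n).

Lemma derive_grad f x v : differentiable f x -> 'D_v f x = dot (grad f x) v.
Proof.
move=> fx; rewrite deriveE// [in LHS](row_sum_delta v) linear_sum.
by apply: eq_bigr => i _; rewrite linearZ/= mxE deriveE// mulrC.
Qed.

Lemma is_derive_line (V : normedModType R) (g : 'rV[R]_n -> V) p d (t : R) :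
  differentiable g (p + t *: d) ->
  is_derive t 1 (fun s : R => g (p + s *: d)) ('D_d g (p + t *: d)).
Proof.
move=> gt; pose line (s : R) := p + s *: d.
have line_diff : is_diff t line ( *:%R^~ d).
  have -> : line = cst p + *:%R^~ d by apply/funext.
  apply: is_diff_eq; by rewrite add0r.
have g_line : differentiable (g \o line) t by exact: differentiable_comp.
split; first exact: diff_derivable.
by rewrite deriveE// diff_comp//= deriveE// diff_val/= scale1r.
Qed.

Lemma grad_continuous (U : set 'rV[R]_n) f x :
  C2_on U f -> U x -> {for x, continuous (grad f)}.
Proof. by move=> f_C2 /f_C2[_ gf _]; exact: differentiable_continuous. Qed.

Lemma mean_value01 (phi dphi : R -> R) :
  (forall t : R, 0 <= t <= 1 -> is_derive t 1 phi (dphi t)) ->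
  exists2 t : R, 0 <= t <= 1 & phi 1 - phi 0 = dphi t.
Proof.
move=> phi_derive; have [| |t] := @MVT R phi dphi 0 1 ltr01.
- move=> t; rewrite in_itv => /andP[t0 t1]; apply: phi_derive.
  by rewrite !ltW.
- apply: derivable_within_continuous => t; rewrite in_itv => t01.
  by have [] := phi_derive t t01.
rewrite in_itv/= => /andP[t0 t1]; rewrite subr0 mulr1.
by move=> ->; exists t; rewrite ?(ltW t0) ?(ltW t1).
Qed.

(** The difference quotients of f at p towards q are at most f q - f p by
    convexity, and they tend to the directional derivative. *)
Lemma gradient_inequality (U : set 'rV[R]_n) f p q :
  convex_function U f -> differentiable f p ->
  U p -> U q -> f p + dot (grad f p) (q - p) <= f q.
Proof.
move=> f_convex fp Up Uq; rewrite -lerBrDl -derive_grad//.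
have dfp : derivable f p (q - p) by exact: diff_derivable.
have /cvg_dnbhs_at_right cf := dfp.
apply: (cvgr_to_le cf); near=> h.
have h0 : 0 < h by near: h; exact: nbhs_right_gt.
have h1 : h <= 1 by near: h; exact: nbhs_right_le.
rewrite /= [_ *: _]mulrC ler_pdivrMr// [leRHS]mulrC.
have := f_convex (Itv01 (ltW h0) h1) q p (mem_set Uq) (mem_set Up).
rewrite convRE/= /conv/=.
have -> : h *: q + (1 - h) *: p = h *: (q - p) + p.
  by rewrite scalerBl scale1r scalerBr addrA addrAC.
by rewrite /shift/= /unstable.onem; lra.
Unshelve. all: by end_near. Qed.

(** The fixed vector d comes first so that the partial application [dotr d] can
    carry a linear structure, hence a differential. *)
Definition dotr d v : R := dot v d.

Lemma dotr_is_linear d : linear (dotr d : 'rV[R]_n -> R).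
Proof. by move=> a u v; rewrite /dotr dotDl dotZl. Qed.

HB.instance Definition _ d :=
  GRing.isLinear.Build R 'rV[R]_n R *:%R (dotr d) (dotr_is_linear d).

Lemma dotr_continuous d : continuous (dotr d).
Proof.
by move=> v; apply: (@dot_cvg _ _ _ (nbhs v)); [exact: cvg_id|exact: cvg_cst].
Qed.

Lemma is_derive_grad_line (U : set 'rV[R]_n) f p d (t : R) :
  C2_on U f -> U (p + t *: d) ->
  is_derive t 1 (fun s : R => dot (grad f (p + s *: d)) d)
    (dot (d *m jacobian (grad f) (p + t *: d)) d).
Proof.
move=> f_C2 /f_C2[_ gf _].
pose F : {linear 'rV[R]_n -> R} := dotr d.
have F_cont : continuous F by exact: dotr_continuous.
have F_diff u : differentiable F u by exact: linear_differentiable.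
have F_grad : differentiable (F \o grad f) (p + t *: d).
  exact: differentiable_comp.
have := is_derive_line F_grad.
by rewrite deriveE// diff_comp//= diff_lin// -deriveE// deriveEjacobian.
Qed.

Lemma norm_row_mul_le d (A : 'M[R]_n) : `|d *m A| <= n%:R * `|d| * `|A|.
Proof.
apply: norm_le_coords => [|i]; first by rewrite !mulr_ge0.
rewrite mxE; apply: le_trans (ler_norm_sum _ _ _) _.
rewrite -mulrA mulr_natl -[X in _ *+ X]card_ord -sumr_const.
by apply: ler_sum => j _; rewrite normrM ler_pM ?entry_le_norm.
Qed.

Lemma quadratic_form_le d (A : 'M[R]_n) :
  dot (d *m A) d <= n%:R ^+ 2 * `|A| * dot d d.
Proof.
apply: le_trans (dot_le_norm _ _) _.
apply: (@le_trans _ _ (n%:R * (n%:R * `|d| * `|A|) * `|d|)).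
  by rewrite ler_wpM2r// ler_wpM2l// norm_row_mul_le.
have -> : n%:R * (n%:R * `|d| * `|A|) * `|d| = n%:R ^+ 2 * `|A| * `|d| ^+ 2.
  by ring.
by rewrite ler_wpM2l ?sqr_norm_le_dot// mulr_ge0// sqr_ge0.
Qed.

Lemma ball_segment x p q e (t : R) :
  ball x e p -> ball x e q -> 0 <= t <= 1 -> ball x e (p + t *: (q - p)).
Proof.
rewrite -!ball_normE/= => xp xq /andP[t0 t1].
have -> : x - (p + t *: (q - p)) = (1 - t) *: (x - p) + t *: (x - q).
  rewrite !scalerBr !scalerBl !scale1r; apply/rowP => i; rewrite !mxE; ring.
apply: le_lt_trans (ler_normD _ _) _; rewrite !normrZ.
rewrite (ger0_norm t0) ger0_norm ?subr_ge0//.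
have -> : e = (1 - t) * e + t * e by ring.
have [->|tN0] := eqVneq t 0; first by rewrite subr0 !mul1r !mul0r !addr0.
by rewrite ler_ltD ?ler_wpM2l ?subr_ge0 ?(ltW xp)// ltr_pM2l// lt_def tN0.
Qed.

(** The Hessian is continuous, hence bounded on a small ball, which is convex:
    the mean value theorem applies on segments inside it.  Only the component of
    the gradient increment along q - p is bounded, so that the scalar mean value
    theorem suffices. *)
Lemma grad_locally_lipschitz (U : set 'rV[R]_n) f x :
  open U -> C2_on U f -> U x ->
  exists2 L : R, 0 < L &
  exists2 e : R, 0 < e & ball x e `<=` U /\
    forall p q, ball x e p -> ball x e q ->
      dot (grad f q - grad f p) (q - p) <= L * dot (q - p) (q - p).
Proof.
move=> U_open f_C2 Ux; have [_ _ Jx] := f_C2 x Ux.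
pose M := `|jacobian (grad f) x| + 1.
have J_bnd : \forall z \near x, `|jacobian (grad f) z| < M.
  by apply: cvgr_norm_lt Jx _ _; rewrite ltrDl.
have : \forall z \near x, U z /\ `|jacobian (grad f) z| < M.
  by apply: filterI => //; exact: open_nbhs_nbhs.
move=> /nbhs_ballP[e e0 xe].
have M0 : 0 < M by rewrite ltr_wpDl.
exists (n%:R ^+ 2 * M + 1); first by rewrite ltr_wpDl// mulr_ge0 ?sqr_ge0// ltW.
exists e => //; split=> [z /xe[]//|p q xp xq].
have seg (t : R) : 0 <= t <= 1 -> ball x e (p + t *: (q - p)).
  exact: ball_segment.
have [t t01] := @mean_value01 (fun s => dot (grad f (p + s *: (q - p))) (q - p))
  (fun t => dot ((q - p) *m jacobian (grad f) (p + t *: (q - p))) (q - p))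
  (fun t t01 => is_derive_grad_line f_C2 (proj1 (xe _ (seg t t01)))).
rewrite scale1r scale0r addr0 (addrC p) subrK dotDl dotNl => ->.
apply: le_trans (quadratic_form_le _ _) _.
rewrite ler_wpM2r ?dot_ge0//.
have [_ Jt] := xe _ (seg t t01).
by rewrite ler_wpDr// ler_wpM2l ?sqr_ge0// ltW.
Qed.

End Derivatives.

(** * One trial point *)

Section OneTrial.
Context {R : realType} {n : nat} (C U : set 'rV[R]_n) (f : 'rV[R]_n -> R).
Context (C_neq0 : C !=set0) (C_compact : compact C)
  (C_convex : convex_set C).
Context (U_open : open U) (f_C2 : C2_on U f) (f_convex : convex_function U f).
Implicit Types (p q x y : 'rV[R]_n) (a : R).

Let f_diff x : U x -> differentiable f x.
Proof. by case/f_C2. Qed.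

Lemma trial_in p a : C (trial C f p a).
Proof. exact: proj_in. Qed.

(** This is the variational inequality of the projection at the base point p
    itself.  It makes the slope towards the trial point nonpositive, of size at
    least the squared displacement over a. *)
Lemma trial_displacement p a : C p ->
  dot (trial C f p a - p) (trial C f p a - p) <=
  - (a * dot (grad f p) (trial C f p a - p)).
Proof.
move=> Cp; rewrite /trial; set q := Defs.proj _ _.
have := proj_variational C_neq0 C_compact C_convex (p - a *: grad f p) Cp.
rewrite -/q !dotE (dotC q p); lra.
Qed.

(** The variational inequality at an arbitrary y, with the squares completed. *)
Lemma trial_three_point p a q y : q = trial C f p a -> C y ->
  dot (q - y) (q - y) <= dot (p - y) (p - y) - dot (q - p) (q - p)
    + 2 * a * dot (grad f p) (y - q).
Proof.
move=> qE Cy.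
have := proj_variational C_neq0 C_compact C_convex (p - a *: grad f p) Cy.
rewrite -/(trial C f p a) -qE !dotE (dotC q p) (dotC y p) (dotC y q); lra.
Qed.

(** A trial point equal to p turns the three-point inequality into
    0 <= dot (grad f p) (y - p), which is optimality for a convex function. *)
Lemma stationary_minimizer p a : (C `&` U) p -> 0 < a ->
  stationarity C f p a <= 0 -> is_minimizer (C `&` U) f p.
Proof.
move=> [Cp Up] a0; rewrite /stationarity pmulr_lle0 ?invr_gt0// => stat.
have qp : trial C f p a = p.
  apply/subr0_eq/dot_eq0/eqP; rewrite -sqr_enorm sqrf_eq0.
  by rewrite eq_le stat sqrtr_ge0.
split=> // y [Cy Uy].
have := gradient_inequality f_convex (f_diff Up) Up Uy.
have := trial_three_point (esym qp) Cy; rewrite subrr.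
have -> : dot 0 (0 : 'rV[R]_n) = 0.
  by rewrite /dot big1// => i _; rewrite mxE mul0r.
rewrite subr0 lerDl pmulr_rge0 ?mulr_gt0//; lra.
Qed.

Section Accepted.
Context (sigma abar a : R) (p : 'rV[R]_n).
Context (sigma_gt0 : 0 < sigma) (a_gt0 : 0 < a) (a_le : a <= abar).
Context (p_CU : (C `&` U) p) (p_acc : accepts C U f sigma p a).
Let q := trial C f p a.

Lemma accepted_in : (C `&` U) q.
Proof. by split; [exact: trial_in|have [] := p_acc]. Qed.

Lemma trial_slope_le0 : dot (grad f p) (q - p) <= 0.
Proof.
have := trial_displacement a (proj1 p_CU).
move=> /(le_trans (dot_ge0 _)); rewrite oppr_ge0 -/q.
by rewrite pmulr_rle0.
Qed.

Lemma accepted_descent : f q <= f p.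
Proof.
have [_ /le_trans->//] := p_acc.
by rewrite gerDl mulr_ge0_le0 ?trial_slope_le0// ltW.
Qed.

(** In the three-point inequality split y - q at p: the slope along y - p is
    bounded by convexity, and the slope along p - q is paid for by the decrease
    of f through the Armijo test.  The sum over the iterations of this payment
    telescopes, because its coefficient is the same for all steps. *)
Lemma accepted_quasi_fejer y : (C `&` U) y ->
  dot (q - y) (q - y) + 2 * a * (f p - f y) <=
  dot (p - y) (p - y) + 2 * abar / sigma * (f p - f q).
Proof.
move=> [Cy Uy]; have [_ Up] := p_CU.
have grad_y := gradient_inequality f_convex (f_diff Up) Up Uy.
have := trial_three_point (erefl q) Cy.
have := dot_ge0 (q - p).
have [_ armijo] := p_acc; rewrite -/q in armijo.
have slope_le : dot (grad f p) (p - q) <= (f p - f q) / sigma.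
  rewrite ler_pdivlMr// mulrC -(opprB q p) dotNr; lra.
have decr : 0 <= (f p - f q) / sigma.
  by rewrite divr_ge0 ?(ltW sigma_gt0)// subr_ge0 accepted_descent.
have : 2 * a * dot (grad f p) (p - q) <= 2 * abar * ((f p - f q) / sigma).
  apply: (@le_trans _ _ (2 * a * ((f p - f q) / sigma))).
    by rewrite ler_pM2l// mulr_gt0.
  by rewrite ler_wpM2r// ler_pM2l.
have : 2 * a * dot (grad f p) (y - p) <= 2 * a * (f y - f p).
  by rewrite ler_pM2l ?mulr_gt0//; lra.
have -> : dot (grad f p) (y - q) =
          dot (grad f p) (y - p) + dot (grad f p) (p - q).
  by rewrite -dotDr addrA subrK.
rewrite -(mulrA (2 * abar)) (mulrC _^-1); lra.
Qed.

End Accepted.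

(** The step bound is uniform over the points of C near x, not only at x: this
    is what keeps the accepted steps away from 0 along a convergent run.
    Convexity and the local Lipschitz bound L give
      f q - f p <= s + L |q - p|^2   with s = dot (grad f p) (q - p) <= 0,
    and |q - p|^2 <= - a s, so that the Armijo test holds as soon as
    a L <= 1 - sigma.  The argument needs q in the ball of radius e where L is
    valid, which the sup norm bound |q - p| <= a n |grad f p| ensures for small
    a. *)
Lemma small_steps_accepted sigma x : sigma < 1 -> (C `&` U) x ->
  exists2 a0 : R, 0 < a0 &
  \forall p \near x, C p -> forall a, 0 < a <= a0 -> accepts C U f sigma p a.
Proof.
move=> sigma_lt1 [Cx Ux].
have [L L0 [e e0 [xe lip]]] := grad_locally_lipschitz U_open f_C2 Ux.
pose M := `|grad f x| + 1.
have M0 : 0 < M by rewrite ltr_wpDl.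
have nM0 : 0 <= n%:R * M by rewrite mulr_ge0// ltW.
(* The first bound keeps q within e / 2 of p, the second gives a L <= 1 - sigma;
   the + 1 makes the denominator positive in dimension 0 as well. *)
exists (Num.min (e / 2 / (n%:R * M + 1)) ((1 - sigma) / L)).
  by rewrite lt_min !divr_gt0 ?subr_gt0// ltr_wpDl.
have e20 : 0 < e / 2 by rewrite divr_gt0.
have near_x : \forall p \near x, ball x (e / 2) p by exact: nbhsx_ballx.
have grad_bnd : \forall p \near x, `|grad f p| < M.
  by apply: cvgr_norm_lt (grad_continuous f_C2 Ux) _ _; rewrite ltrDl.
apply: filterS2 near_x grad_bnd => p xp gp Cp a /andP[a0].
rewrite le_min => /andP[a_small aL].
have disp := trial_displacement a Cp.
rewrite /accepts; set q := trial C f p a in disp *.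
have qp : `|q - p| < e / 2.
  have [->|qpN0] := eqVneq `|q - p| 0; first by [].
  have qp0 : 0 < `|q - p| by rewrite lt_def qpN0/=.
  have : `|q - p| * `|q - p| <= a * (n%:R * M) * `|q - p|.
    rewrite -expr2; apply: le_trans (sqr_norm_le_dot _) _.
    apply: le_trans disp _; rewrite -mulrN -dotNl -mulrA ler_pM2l//.
    apply: le_trans (dot_le_norm _ _) _; rewrite normrN.
    by rewrite ler_wpM2r// ler_wpM2l// ltW.
  rewrite ler_pM2r// => /le_lt_trans; apply.
  apply: (@lt_le_trans _ _ (a * (n%:R * M + 1))).
    by rewrite ltr_pM2l// ltrDl.
  by rewrite -ler_pdivlMr// ltr_wpDl.
have xq : ball x e q.
  rewrite (splitr e); apply: ball_triangle xp _.
  by rewrite -ball_normE/= distrC.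
have xp' : ball x e p by apply: le_ball xp; lra.
split; first exact: xe.
(* The gradient inequality is taken at q, not at p, to bound f q from above. *)
have := gradient_inequality f_convex (f_diff (xe _ xq)) (xe _ xq) (xe _ xp').
have := lip _ _ xp' xq; rewrite -(opprB q p) dotNr dotDl dotNl.
set D := dot (q - p) (q - p) in disp *.
set s := dot (grad f p) (q - p) in disp *.
move=> lip_pq grad_q.
have : L * D <= (1 - sigma) * - s.
  rewrite -(ler_pM2l a0) mulrCA.
  have -> : a * ((1 - sigma) * - s) = (1 - sigma) * - (a * s) by ring.
  apply: (@le_trans _ _ ((1 - sigma) * D)); last first.
    by rewrite ler_pM2l// subr_gt0.
  rewrite mulrA ler_wpM2r ?dot_ge0// mulrC.
  by rewrite -ler_pdivlMr.
lra.
Qed.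

End OneTrial.

(** * The backtracking loop *)

Section Backtracking.
Context {R : realType} {n : nat} (C U : set 'rV[R]_n) (f : 'rV[R]_n -> R).
Context (sigma rho : R) (rho_01 : 0 < rho < 1) (p : 'rV[R]_n).

Lemma backtrack_accepted a b : backtrack C U f sigma rho p a b -> 0 < a ->
  [/\ 0 < b, b <= a & accepts C U f sigma p b].
Proof.
have /andP[rho0 rho1] := rho_01.
elim=> {a b} [a|a b _ _ IH a0]; first by split.
have [|b0 ba acc] := IH; first by rewrite mulr_gt0.
by split=> //; apply: le_trans ba _; rewrite ger_pMl// ltW.
Qed.

(** Either the initial step a is accepted, or the last rejected step exceeds a0
    and the accepted one is rho times it. *)
Lemma backtrack_ge a0 a b :
  (forall t, 0 < t <= a0 -> accepts C U f sigma p t) ->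
  backtrack C U f sigma rho p a b -> 0 < a -> Num.min a (rho * a0) <= b.
Proof.
have /andP[rho0 rho1] := rho_01.
move=> small_acc; elim=> {a b} [a _ a_gt0|a b rej _ IH a_gt0].
  by rewrite ge_min lexx.
have a0a : a0 <= a.
  by rewrite leNgt; apply/negP => aa0; apply/rej/small_acc; rewrite a_gt0 ltW.
apply: le_trans (IH _); last by rewrite mulr_gt0.
by rewrite (min_r (_ : rho * a0 <= rho * a)) ?ler_pM2l// ge_min lexx orbT.
Qed.

Lemma backtrack_exits a0 a : 0 < a0 ->
  (forall t, 0 < t <= a0 -> accepts C U f sigma p t) -> 0 < a ->
  exists b, backtrack C U f sigma rho p a b.
Proof.
have /andP[rho0 rho1] := rho_01.
move=> a0_gt0 small_acc a_gt0.
have [N rhoN] : exists N, rho ^+ N * a <= a0.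
  have /cvgr_lt /(_ (a0 / a)) : rho ^+ N @[N --> \oo] --> (0 : R).
    by apply: cvg_expr; rewrite ger0_norm// ltW.
  rewrite divr_gt0// => /(_ isT) [N _ /(_ N (leqnn N))] /= rhoN.
  by exists N; rewrite -ler_pdivlMr// ltW.
elim: N a a_gt0 rhoN => [|N IH] a a_gt0.
  rewrite mul1r => aa0; exists a; apply: BtAccept; apply: small_acc.
  by rewrite a_gt0.
rewrite exprSr -mulrA => /(IH (rho * a) (mulr_gt0 rho0 a_gt0))[b bb].
have [acc|rej] := pselect (accepts C U f sigma p a).
  by exists a; exact: BtAccept.
by exists b; exact: BtReject.
Qed.

End Backtracking.

(** * Convergence of infinite runs *)

Section Convergence.
Context {R : realType} {n : nat} (C U : set 'rV[R]_n) (f : 'rV[R]_n -> R).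
Context (C_neq0 : C !=set0) (C_compact : compact C)
  (C_convex : convex_set C).
Context (U_open : open U) (f_C2 : C2_on U f) (f_convex : convex_function U f).
Context (f_blowup : forall a : R, sublevel (C `&` U) f a !=set0 ->
  (0 < set_dist (sublevel (C `&` U) f a) (~` U))%E).

Lemma f_continuous x : U x -> {for x, continuous f}.
Proof. by case/f_C2 => fx _ _; exact: differentiable_continuous. Qed.

Lemma sqr_dist_continuous y :
  continuous (fun z : 'rV[R]_n => dot (z - y) (z - y)).
Proof.
move=> x; have zy : (fun z : 'rV[R]_n => z - y) @ x --> x - y.
  by apply: (@cvgB _ _ _ (nbhs x)); [exact: cvg_id|exact: cvg_cst].
exact: (dot_cvg zy zy).
Qed.

(** A limit of points of the sublevel set lies in C; it lies in U because these
    points stay at a positive distance from the complement of U. *)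
Lemma sublevel_closed (a : R) : closed (sublevel (C `&` U) f a).
Proof.
set S := sublevel _ _ _ => x Sx.
have Cx : C x.
  apply: (compact_closed (@norm_hausdorff _ 'rV[R]_n) C_compact).
  by apply: closure_subset Sx => z [[]].
have Ux : U x.
  apply: contrapT => NUx; have [z0 [Sz0 _]] := Sx setT filterT.
  have S_dist := f_blowup (ex_intro _ z0 Sz0).
  have dist_le z : S z -> (set_dist S (~` U) <= (enorm (z - x))%:E)%E.
    by move=> Sz; apply: ereal_inf_lbound; exists z => //; exists x.
  case: (set_dist S (~` U)) S_dist dist_le => [d||]; last by [].
  - rewrite lte_fin => d0 dist_le.
    have near_x : \forall z \near x, dot (z - x) (z - x) < d ^+ 2.
      have := @sqr_dist_continuous x x; rewrite /continuous_at.
      have -> : dot (x - x) (x - x) = 0.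
        by rewrite subrr /dot big1// => i _; rewrite mxE mul0r.
      by move=> /cvgr_lt; apply; rewrite exprn_gt0.
    have [z [Sz]] := Sx _ near_x.
    rewrite -sqr_enorm ltNge => /negP; apply.
    have := dist_le z Sz; rewrite lee_fin => dz.
    by rewrite ler_pXn2r ?nnegrE ?sqrtr_ge0// ltW.
  - by move=> _ /(_ z0 Sz0).
split=> //; rewrite leNgt; apply/negP => afx.
have near_x : \forall z \near x, a < f z.
  exact: (cvgr_gt _ (f_continuous Ux)).
have [z [[_ fz]]] := Sx _ near_x.
by rewrite ltNge fz.
Qed.

Context (sigma abar rho : R) (sigma_01 : 0 < sigma < 1) (abar_gt0 : 0 < abar)
  (rho_01 : 0 < rho < 1).
Context (p : nat -> 'rV[R]_n) (al : nat -> R).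
Context (p0_CU : (C `&` U) (p 0%N)).
Context (p_bt : forall k, backtrack C U f sigma rho (p k) abar (al k)).
Context (p_next : forall k, p k.+1 = trial C f (p k) (al k)).

Let al_acc k := backtrack_accepted rho_01 (p_bt k) abar_gt0.
Let sigma_gt0 : 0 < sigma. Proof. by case/andP: sigma_01. Qed.

Lemma iterates_in k : (C `&` U) (p k).
Proof.
elim: k => // k IH; rewrite p_next; have [_ _ acc] := al_acc k.
exact: accepted_in acc.
Qed.

Lemma iterates_descent k j : (k <= j)%N -> f (p j) <= f (p k).
Proof.
apply: (homo_leq (r := fun x y => y <= x) (f := fun k => f (p k))) => //.
  by move=> x y z /[swap]; exact: le_trans.
move=> i; have [al0 _ acc] := al_acc i; rewrite p_next.
exact: accepted_descent (iterates_in i) acc.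
Qed.

Let c := 2 * abar / sigma.

(** The squared distance to y alone need not decrease along the run; the added
    multiple of f absorbs the error term of [accepted_quasi_fejer]. *)
Let lyap y z := dot (z - y) (z - y) + c * f z.

Lemma lyap_cvg y x : U x -> lyap y z @[z --> x] --> lyap y x.
Proof.
move=> Ux; apply: (@cvgD _ _ _ (nbhs x)); first exact: sqr_dist_continuous.
by apply: (@cvgM _ _ (nbhs x)); [exact: cvg_cst|exact: f_continuous].
Qed.

Lemma lyap_step y k : (C `&` U) y ->
  lyap y (p k.+1) + 2 * al k * (f (p k) - f y) <= lyap y (p k).
Proof.
move=> y_CU; have [al0 al_le acc] := al_acc k.
have := accepted_quasi_fejer C_neq0 C_compact C_convex f_C2 f_convex
  sigma_gt0 al0 al_le (iterates_in k) acc y_CU.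
rewrite -p_next /lyap -/c; lra.
Qed.

(** With x a cluster point, [lyap x] is nonincreasing along the run and comes
    arbitrarily close to c * f x, a lower bound of its values there; once close
    it stays close, which bounds the distance to x. *)
Lemma iterates_converge :
  exists2 x, p @ \oo --> x & (C `&` U) x /\ forall k, f x <= f (p k).
Proof.
have [x [Cx x_cluster]] : C `&` cluster (p @ \oo) !=set0.
  by apply: C_compact; exists 0%N => // k _; have [] := iterates_in k.
(* Each tail of the run lies in a closed sublevel set, hence so does x. *)
have x_sub k : sublevel (C `&` U) f (f (p k)) x.
  apply: sublevel_closed => B xB; apply: x_cluster xB.
  exists k => // j /= kj; split; first exact: iterates_in.
  exact: iterates_descent.
exists x; last by have [x_CU _] := x_sub 0%N; split=> // k; have [] := x_sub k.
have x_CU : (C `&` U) x by have [] := x_sub 0%N.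
have fx k : f x <= f (p k) by have [] := x_sub k.
have c_ge0 : 0 <= c by rewrite /c divr_ge0 ?mulr_ge0 ?ltW.
have lyap_mono k j : (k <= j)%N -> lyap x (p j) <= lyap x (p k).
  apply: (homo_leq (r := fun x y => y <= x) (f := fun k => lyap x (p k))) => //.
    by move=> ? ? ? /[swap]; exact: le_trans.
  move=> i; apply: le_trans (lyap_step i x_CU).
  have [al0 _ _] := al_acc i.
  by rewrite lerDl mulr_ge0 ?subr_ge0// mulr_ge0 ?ltW.
apply/cvgrPdist_lt => e e0.
have near_x : \forall z \near x, lyap x z < c * f x + e ^+ 2.
  apply: cvgr_lt (lyap_cvg (proj2 x_CU)) _ _.
  rewrite /lyap subrr /dot big1 => [|i _]; last by rewrite mxE mul0r.
  by rewrite add0r ltrDl exprn_gt0.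
have [_ [[k _ <-] pk]] :
    range p `&` [set z | lyap x z < c * f x + e ^+ 2] !=set0.
  by apply: x_cluster near_x; exists 0%N => // k _; exists k.
exists k => // j /= kj; have := le_lt_trans (lyap_mono _ _ kj) pk.
rewrite /lyap => lyap_lt; rewrite distrC.
rewrite -(ltr_pXn2r (n := 2)) ?nnegrE ?normr_ge0 ?ltW//.
apply: le_lt_trans (sqr_norm_le_dot _) _.
have := ler_wpM2l c_ge0 (fx j); lra.
Qed.

(** If y were better than the limit x, then [lyap y] would converge along the
    run while decreasing each time by at least 2 m (f x - f y), m being a lower
    bound on the late steps. *)
Lemma iterates_cvg_minimizer :
  exists2 x, p @ \oo --> x & is_minimizer (C `&` U) f x.
Proof.
have [x px [x_CU fx]] := iterates_converge; exists x => //; split=> // y y_CU.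
rewrite leNgt; apply/negP => fyx.
have /andP[rho0 _] := rho_01; have /andP[_ sigma1] := sigma_01.
have [a0 a0_gt0 near_acc] := small_steps_accepted C_neq0 C_compact C_convex
  U_open f_C2 f_convex sigma1 x_CU.
pose m := Num.min abar (rho * a0).
have m0 : 0 < m by rewrite lt_min abar_gt0 mulr_gt0.
have al_ge : \forall k \near \oo, m <= al k.
  apply: (@filterS _ \oo _ _ _ _ (px _ near_acc)) => k /= acc_k.
  apply: backtrack_ge (p_bt k) abar_gt0 => //; apply: acc_k.
  by case: (iterates_in k).
have lyap_p : lyap y (p k) @[k --> \oo] --> lyap y x.
  exact: (cvg_comp _ _ px (@lyap_cvg y x (proj2 x_CU))).
have lyap_p1 : lyap y (p k.+1) @[k --> \oo] --> lyap y x.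
  by rewrite (cvg_shiftS (fun k => lyap y (p k))).
have gap : 0 < 2 * m * (f x - f y) by rewrite !mulr_gt0// subr_gt0.
suff : lyap y x + 2 * m * (f x - f y) <= lyap y x by lra.
apply: ler_cvg_to (cvgD lyap_p1 (cvg_cst (2 * m * (f x - f y)))) lyap_p _.
near=> k.
apply: le_trans (lyap_step k y_CU); rewrite lerD2l.
apply: ler_pM; rewrite ?subr_ge0 ?(ltW fyx) ?mulr_ge0 ?(ltW m0)//.
  by rewrite ler_pM2l//; near: k.
by rewrite lerD2r.
Unshelve. all: by end_near. Qed.

End Convergence.

(** * Runs of the method *)

Section Runs.
Context {R : realType} {n : nat} (C U : set 'rV[R]_n) (f : 'rV[R]_n -> R).
Context (abar sigma rho : R) (al : 'rV[R]_n -> R).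
Context (al_bt : forall p, (C `&` U) p ->
  backtrack C U f sigma rho p abar (al p)).

Let next p := trial C f p (al p).

Context (next_in : forall p, (C `&` U) p -> (C `&` U) (next p)).

(** The method may stop earlier than at the given iterate k, so the returned
    point is only known to be one that passes the stopping test. *)
Lemma returns_of_stationary k p : (C `&` U) p ->
  stationarity C f (iter k next p) (al (iter k next p)) <= 0 ->
  exists2 r, armijo_pg_returns C U f abar sigma rho 0 p r &
    (C `&` U) r /\ stationarity C f r (al r) <= 0.
Proof.
elim: k p => [|k IH] p p_CU stat_k.
  by exists p => //; apply: PgStop (al_bt p_CU) stat_k.
have [stat_p|stat_p] := leP (stationarity C f p (al p)) 0.
  by exists p => //; apply: PgStop (al_bt p_CU) stat_p.
have [|r ret_r r_stat] := IH (next p) (next_in p_CU); first by rewrite -iterSr.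
by exists r => //; exact: PgStep (al_bt p_CU) stat_p ret_r.
Qed.

End Runs.

Theorem corollary2 (R : realType) (n : nat) (C U : set 'rV[R]_n)
    (f : 'rV[R]_n -> R) (abar sigma rho : R) (p0 : 'rV[R]_n)
    (C_neq0 : C !=set0) (C_compact : compact C) (C_convex : convex_set C)
    (U_open : open U) (U_convex : convex_set U)
    (CU_neq0 : C `&` U !=set0)
    (f_C2 : C2_on U f) (f_convex : convex_function U f)
    (f_blowup : forall a : R, sublevel (C `&` U) f a !=set0 ->
      (0 < set_dist (sublevel (C `&` U) f a) (~` U))%E)
    (p0_CU : (C `&` U) p0) (abar_gt0 : 0 < abar)
    (sigma_01 : 0 < sigma < 1) (rho_01 : 0 < rho < 1) :
  (exists2 r : 'rV[R]_n,
     armijo_pg_returns C U f abar sigma rho 0 p0 r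
     & is_minimizer (C `&` U) f r) \/
  (exists2 p : nat -> 'rV[R]_n,
     armijo_pg_generates C U f abar sigma rho 0 p0 p
     & exists2 r : 'rV[R]_n, p @ \oo --> r & is_minimizer (C `&` U) f r).
Proof.
have /andP[sigma_gt0 sigma_lt1] := sigma_01.
(* Turn the exit step of the loop into a function of the current point, so that
   the iterates can be defined before knowing whether the method stops. *)
pose al p := xget 0 [set b | backtrack C U f sigma rho p abar b].
have al_bt p : (C `&` U) p -> backtrack C U f sigma rho p abar (al p).
  move=> p_CU.
  apply: (@xgetPex _ 0 [set b | backtrack C U f sigma rho p abar b]).
  have [a0 a0_gt0 near_acc] := small_steps_accepted C_neq0 C_compact C_convex
    U_open f_C2 f_convex sigma_lt1 p_CU.
  have [b p_b] := backtrack_exits rho_01 a0_gt0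
    (nbhs_singleton near_acc (proj1 p_CU)) abar_gt0.
  by exists b.
have al_acc p (p_CU : (C `&` U) p) :=
  backtrack_accepted rho_01 (al_bt p p_CU) abar_gt0.
pose next p := trial C f p (al p).
have next_in p : (C `&` U) p -> (C `&` U) (next p).
  by move=> p_CU; have [_ _ acc] := al_acc p p_CU; exact: accepted_in acc.
pose p k := iter k next p0.
have p_in k : (C `&` U) (p k) by elim: k => // k; exact: next_in.
have [[k stat_k]|no_stop] :=
    pselect (exists k, stationarity C f (p k) (al (p k)) <= 0).
  left; have [r ret_r [r_CU r_stat]] :=
    returns_of_stationary al_bt next_in p0_CU stat_k.
  exists r => //; have [al_gt0 _ _] := al_acc r r_CU.
  exact: stationary_minimizer r_CU al_gt0 r_stat.
right; exists p.
  split=> // k; exists (al (p k)); split=> //; first exact: al_bt.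
  by rewrite ltNge; apply/negP => stat_k; apply: no_stop; exists k.
exact: (iterates_cvg_minimizer C_neq0 C_compact C_convex U_open f_C2 f_convex
  f_blowup sigma_01 abar_gt0 rho_01 p0_CU (fun k => al_bt _ (p_in k))).
Qed.
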